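(* Let $(c^{n},\bar\mu_c^{n},\bar p^{n},\tilde{\boldsymbol u}^n,\boldsymbol{u}^{n})_{n\ge 0}$, $\boldsymbol{u}^n=(u^n,v^n)$, $\tilde{\boldsymbol u}^n=(\tilde u^n,\tilde v^n)$, be grid functions such that, for every $n\ge 0$, the data at levels $n$ and $n+1$ satisfy the fully discrete projection scheme (equations (J1)--(J7) of the context), and such that the discrete boundary conditions of the context hold at every level. Write $\rho^n=\rho(c^n)$, $\mu_c^n=\bar\mu_c^n+\alpha\bar p^n$, and define the discrete total energy $$E_h^n=\frac12\big\|\sqrt{\rho^n}\,\boldsymbol u^n\big\|_2^2+\frac{\epsilon\eta}{2We}\big\|\sqrt{\rho^n}\,\boldsymbol\nabla_Dc^n\big\|_2^2+\frac{\eta h^2}{\epsilon We}\big(\rho^nF(c^n),1\big)_2+\frac{h^2}{Fr}\big(\rho^ny,1\big)_2 .$$ Then the scheme is energy stable: for all $n\ge0$, $$\begin{aligned}E_h^{n+1}-E_h^n=&-\frac{\delta t}{Re}\big\|\sqrt{\mu(c^n)}\,\boldsymbol\nabla_d\tilde{\boldsymbol u}^{n+1}\big\|_2^2-\frac{\delta t}{3Re}\big\|\sqrt{\mu(c^n)}\,\boldsymbol\nabla_d\cdot\tilde{\boldsymbol u}^{n+1}\big\|_2^2-\frac{\delta t}{M\,Pe}\big\|\sqrt{m(c^n)}\,\boldsymbol\nabla_D\mu_c^{n+1}\big\|_2^2\\&-\frac12\big\|\sqrt{\rho^n}(\tilde{\boldsymbol u}^{n+1}-\boldsymbol u^n)\big\|_2^2-\frac12\big\|\sqrt{\rho^{n+1}}(\boldsymbol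 u^{n+1}-\tilde{\boldsymbol u}^{n+1})\big\|_2^2\le0 .\end{aligned}$$
   Context: **Parameters and material functions.** $M,Re,We,Fr,Pe,\eta,\epsilon,\rho_1,\rho_2,\mu_1,\mu_2,\delta t>0$ are constants; $\alpha=(\rho_2-\rho_1)/(\rho_1\rho_2)$; $\rho(c)=\rho_1\rho_2/((\rho_2-\rho_1)c+\rho_1)$; $\mu(c)=\mu_1\mu_2/((\mu_2-\mu_1)c+\mu_1)$ (viscosity); $m(c)=\sqrt{c^2(1-c)^2+\epsilon}$; $F(c)=c^2(c-1)^2/4$; $g(a,b)=\frac14\big(a(a-1)+b(b-1)\big)(a+b-1)$; $r(a,b)=-\alpha\rho(a)\rho(b)$. All values of $c^n$ are such that $(\rho_2-\rho_1)c+\rho_1>0$ and $(\mu_2-\mu_1)c+\mu_1>0$. Superscript $n$ denotes time level $n\delta t$; $\rho^n=\rho(c^n)$, $\rho^{n+\frac12}=\frac12(\rho^{n+1}+\rho^n)$, $c^{n+\frac12}=\frac12(c^{n+1}+c^n)$, $F^{n+\frac12}=\frac12(F(c^{n+1})+F(c^n))$. **Grid.** $\Omega=(0,L_x)\times(0,L_y)$, $L_x=m_1h$, $L_y=m_2h$, $h>0$, $m_1,m_2$ positive integers, $L_x=L_y$. Points: $x_i=(i-\frac12)h$, $x_{i+\frac12}=ih$, $y_j=(j-\frac12)h$, $y_{j+\frac12}=jh$. Cell-centered functions $\phi_{i,j}$ ($c,\bar\mu_c,\mu_c,\bar p$) are indexed by $0\le i\le m_1+1$, $0\le j\le m_2+1$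 (indices $0$, $m_1+1$, $m_2+1$ are ghost points); $y$ also denotes the cell-centered function $y_{i,j}=y_j$. East-west edge-centered functions $u_{i+\frac12,j}$, $\tilde u_{i+\frac12,j}$ live at $(x_{i+\frac12},y_j)$, $0\le i\le m_1$, $1\le j\le m_2$ (for $\tilde u$ also the ghost indices $j=0,m_2+1$); north-south edge-centered functions $v_{i,j+\frac12}$, $\tilde v_{i,j+\frac12}$ at $(x_i,y_{j+\frac12})$, $1\le i\le m_1$, $0\le j\le m_2$ (for $\tilde v$ also the ghost indices $i=0,m_1+1$); vertex-centered functions $f_{i+\frac12,j+\frac12}$, $0\le i\le m_1$, $0\le j\le m_2$. Operators are evaluated only where needed below; products of grid functions at the same type of points are pointwise. **Operators.** - Edge to center: $a_xu_{i,j}=\frac12(u_{i+\frac12,j}+u_{i-\frac12,j})$, $d_xu_{i,j}=\frac1h(u_{i+\frac12,j}-u_{i-\frac12,j})$, $a_yv_{i,j}=\frac12(v_{i,j+\frac12}+v_{i,j-\frac12})$, $d_yv_{i,j}=\frac1h(v_{i,j+\frac12}-v_{i,j-\frac12})$. - Center to edge: $A_x\phi_{i+\frac12,j}=\frac12(\phi_{i+1,j}+\phi_{i,j})$, $D_x\phi_{i+\frac12,j}=\frac1h(\phi_{i+1,j}-\phi_{i,j})$, $A_y\phi_{i,j+\frac12}=\frac12(\phi_{i,j+1}+\phi_{i,j})$, $D_y\phi_{i,j+\frac12}=\frac1h(\phi_{i,j+1}-\phi_{i,j})$. - Center to vertex: $\mathcal A\phi_{i+\frac12,j+\frac12}=\frac14(\phi_{i+1,j+1}+\phi_{i,j+1}+\phi_{i+1,j}+\phi_{i,j})$.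 - Edge to vertex: $\mathcal A_xv_{i+\frac12,j+\frac12}=\frac12(v_{i+1,j+\frac12}+v_{i,j+\frac12})$, $\mathcal D_xv_{i+\frac12,j+\frac12}=\frac1h(v_{i+1,j+\frac12}-v_{i,j+\frac12})$, $\mathcal A_yu_{i+\frac12,j+\frac12}=\frac12(u_{i+\frac12,j+1}+u_{i+\frac12,j})$, $\mathcal D_yu_{i+\frac12,j+\frac12}=\frac1h(u_{i+\frac12,j+1}-u_{i+\frac12,j})$. - Vertex to edge: $\mathfrak A_xf_{i,j+\frac12}=\frac12(f_{i+\frac12,j+\frac12}+f_{i-\frac12,j+\frac12})$, $\mathfrak D_xf_{i,j+\frac12}=\frac1h(f_{i+\frac12,j+\frac12}-f_{i-\frac12,j+\frac12})$, $\mathfrak A_yf_{i+\frac12,j}=\frac12(f_{i+\frac12,j+\frac12}+f_{i+\frac12,j-\frac12})$, $\mathfrak D_yf_{i+\frac12,j}=\frac1h(f_{i+\frac12,j+\frac12}-f_{i+\frac12,j-\frac12})$. - Special advection terms: $a_x(\rho_{ew}D_xc\,u)_{i,j}=\frac12\big(\rho_{i+1,j}D_xc_{i+\frac12,j}u_{i+\frac12,j}+\rho_{i-1,j}D_xc_{i-\frac12,j}u_{i-\frac12,j}\big)$ and $a_y(\rho_{ns}D_yc\,v)_{i,j}=\frac12\big(\rho_{i,j+1}D_yc_{i,j+\frac12}v_{i,j+\frac12}+\rho_{i,j-1}D_yc_{i,j-\frac12}v_{i,j-\frac12}\big)$. - Special surface tension terms: $A_x(\rho_{ew}\bar\mu_c)_{i+\frac12,j}=\frac12(\rho_{i+1,j}\bar\mu_{c\,i,j}+\rho_{i,j}\bar\mu_{c\,i+1,j})$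 and $A_y(\rho_{ns}\bar\mu_c)_{i,j+\frac12}=\frac12(\rho_{i,j+1}\bar\mu_{c\,i,j}+\rho_{i,j}\bar\mu_{c\,i,j+1})$. - Cell-centered squared gradient: $|\nabla_Dc|^2=a_x\big((D_xc)^2\big)+a_y\big((D_yc)^2\big)$, and $(|\nabla_Dc|^2)^{n+\frac12}=\frac12\big(|\nabla_Dc^{n+1}|^2+|\nabla_Dc^{n}|^2\big)$. **Inner product and norms.** $(\phi,\psi)_2=\sum_{i=1}^{m_1}\sum_{j=1}^{m_2}\phi_{i,j}\psi_{i,j}$. For vertex-centered $f$ let $\bar f_{i,j}=\frac14(f_{i+\frac12,j+\frac12}+f_{i-\frac12,j+\frac12}+f_{i+\frac12,j-\frac12}+f_{i-\frac12,j-\frac12})$. For cell-centered $\phi\ge0$, $\psi$ and $\boldsymbol u=(u,v)$: $\|\sqrt\phi\,\boldsymbol u\|_2^2=h^2(\phi,a_x(u^2))_2+h^2(\phi,a_y(v^2))_2$; $\|\sqrt\phi\,\boldsymbol\nabla_D\psi\|_2^2=h^2(\phi,a_x((D_x\psi)^2))_2+h^2(\phi,a_y((D_y\psi)^2))_2$; $\|\sqrt\phi\,\boldsymbol\nabla_d\boldsymbol u\|_2^2=h^2(\phi,(d_xu)^2)_2+h^2(\phi,\overline{(\mathcal D_yu)^2})_2+h^2(\phi,\overline{(\mathcal D_xv)^2})_2+h^2(\phi,(d_yv)^2)_2$; $\|\sqrt\phi\,\boldsymbol\nabla_d\cdot\boldsymbol u\|_2^2=h^2(\phi,(d_xu+d_yv)^2)_2$.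 **Projection scheme.** (J1),(J3) hold at interior east-west edges ($1\le i\le m_1-1$, $1\le j\le m_2$), (J2),(J4) at interior north-south edges ($1\le i\le m_1$, $1\le j\le m_2-1$), (J5)--(J7) at cells $1\le i\le m_1$, $1\le j\le m_2$. (J1) $A_x\rho^n\frac{\tilde u^{n+1}-u^n}{\delta t}+A_x(\rho^na_xu^n\,d_x\tilde u^{n+1})+\mathfrak A_y(\mathcal A\rho^n\mathcal A_xv^n\mathcal D_y\tilde u^{n+1})+\frac12\tilde u^{n+1}\Big(\frac{A_x\rho^{n+1}-A_x\rho^n}{\delta t}+D_x(\rho^na_xu^n)+\mathfrak D_y(\mathcal A\rho^n\mathcal A_xv^n)\Big)=\frac1{Re}\big(D_x(\mu(c^n)d_x\tilde u^{n+1})+\mathfrak D_y(\mathcal A\mu(c^n)\mathcal D_y\tilde u^{n+1})\big)+\frac1{3Re}D_x\big(\mu(c^n)(d_x\tilde u^{n+1}+d_y\tilde v^{n+1})\big)$ (J2) $A_y\rho^n\frac{\tilde v^{n+1}-v^n}{\delta t}+\mathfrak A_x(\mathcal A\rho^n\mathcal A_yu^n\mathcal D_x\tilde v^{n+1})+A_y(\rho^na_yv^n\,d_y\tilde v^{n+1})+\frac12\tilde v^{n+1}\Big(\frac{A_y\rho^{n+1}-A_y\rho^n}{\delta t}+\mathfrak D_x(\mathcal A\rho^n\mathcal A_yu^n)+D_y(\rho^na_yv^n)\Big)=\frac1{Re}\big(\mathfrak D_x(\mathcal A\mu(c^n)\mathcal D_x\tilde v^{n+1})+D_y(\mu(c^n)d_y\tilde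 v^{n+1})\big)+\frac1{3Re}D_y\big(\mu(c^n)(d_x\tilde u^{n+1}+d_y\tilde v^{n+1})\big)$ (J3) $A_x\rho^{n+1}\frac{u^{n+1}-\tilde u^{n+1}}{\delta t}=-\frac1MD_x\bar p^{n+1}+\frac1MA_x(\rho^{n+1}_{ew}\bar\mu_c^{n+1})D_xc^{n+1}$ (J4) $A_y\rho^{n+1}\frac{v^{n+1}-\tilde v^{n+1}}{\delta t}=-\frac1MD_y\bar p^{n+1}+\frac1MA_y(\rho^{n+1}_{ns}\bar\mu_c^{n+1})D_yc^{n+1}-\frac1{Fr}A_y\rho^{n+1}$ (J5) $d_xu^{n+1}+d_yv^{n+1}=\alpha\,Q^{n+1}$, where $Q^{n+1}=\frac1{Pe}\big[d_x(A_xm(c^n)D_x\bar\mu_c^{n+1})+d_y(A_ym(c^n)D_y\bar\mu_c^{n+1})\big]+\frac{\alpha}{Pe}\big[d_x(A_xm(c^n)D_x\bar p^{n+1})+d_y(A_ym(c^n)D_y\bar p^{n+1})\big]$ (J6) $\rho^{n}\frac{c^{n+1}-c^n}{\delta t}+a_x(\rho^{n+1}_{ew}D_xc^{n+1}u^{n+1})+a_y(\rho^{n+1}_{ns}D_yc^{n+1}v^{n+1})=Q^{n+1}$ (J7) $\rho^{n}\bar\mu_c^{n+1}=\frac{M\eta}{\epsilon We}\rho^{n+\frac12}g(c^{n+1},c^n)+\frac{M\eta}{\epsilon We}F^{n+\frac12}r(c^{n+1},c^n)+\frac{\epsilon\eta M}{2We}(|\nabla_Dc|^2)^{n+\frac12}r(c^{n+1},c^n)-\frac{\epsilon\eta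 M}{We}\big[d_x(A_x\rho^{n+\frac12}D_xc^{n+\frac12})+d_y(A_y\rho^{n+\frac12}D_yc^{n+\frac12})\big]$ **Boundary conditions (all levels).** With $\mu_c^n:=\bar\mu_c^n+\alpha\bar p^n$, both $\phi=c^n$ and $\phi=\mu_c^n$ satisfy the discrete Neumann conditions $\phi_{0,j}=\phi_{1,j}$, $\phi_{m_1+1,j}=\phi_{m_1,j}$ ($1\le j\le m_2$), $\phi_{i,0}=\phi_{i,1}$, $\phi_{i,m_2+1}=\phi_{i,m_2}$ ($1\le i\le m_1$). The intermediate velocity satisfies no-slip: $\tilde u_{\frac12,j}=\tilde u_{m_1+\frac12,j}=0$ ($1\le j\le m_2$), $\frac12(\tilde u_{i+\frac12,0}+\tilde u_{i+\frac12,1})=\frac12(\tilde u_{i+\frac12,m_2}+\tilde u_{i+\frac12,m_2+1})=0$ ($0\le i\le m_1$), $\tilde v_{i,\frac12}=\tilde v_{i,m_2+\frac12}=0$ ($1\le i\le m_1$), $\frac12(\tilde v_{0,j+\frac12}+\tilde v_{1,j+\frac12})=\frac12(\tilde v_{m_1,j+\frac12}+\tilde v_{m_1+1,j+\frac12})=0$ ($0\le j\le m_2$); the ghost values at corners are thereby $0$. The velocity satisfies $\boldsymbol n\cdot\boldsymbol u=0$: $u_{\frac12,j}=u_{m_1+\frac12,j}=0$ ($1\le j\le m_2$), $v_{i,\frac12}=v_{i,m_2+\frac12}=0$ ($1\le i\le m_1$). *)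

(* Defs.v *)
From mathcomp Require Import all_boot all_order all_algebra.

Set Implicit Arguments.
Unset Strict Implicit.
Unset Printing Implicit Defensive.

Import Order.TTheory GRing.Theory Num.Theory.
Local Open Scope ring_scope.

(* A half-integer index i + 1/2 is encoded by i, and hence i - 1/2 by i.-1, in
   each of the two directions separately:
     cell f        f i j  stands for  f_{i, j}
     ew_edge f     f i j  stands for  f_{i+1/2, j}
     ns_edge f     f i j  stands for  f_{i, j+1/2}
     vertex f      f i j  stands for  f_{i+1/2, j+1/2}
   Grid functions are total on nat * nat; only the values at the points of the
   grid (ghost points included) are ever constrained or used, and i.-1, j.-1
   are only evaluated at i, j >= 1. *)
Definition grid (R : Type) := nat -> nat -> R.
Definition cell (R : Type) := grid R.
Definition ew_edge (R : Type) := grid R.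
Definition ns_edge (R : Type) := grid R.
Definition vertex (R : Type) := grid R.

Section Pointwise.
Variable R : rcfType.
Definition gadd (f g : grid R) : grid R := fun i j => f i j + g i j.
Definition gsub (f g : grid R) : grid R := fun i j => f i j - g i j.
Definition gmul (f g : grid R) : grid R := fun i j => f i j * g i j.
Definition gscale (a : R) (f : grid R) : grid R := fun i j => a * f i j.
Definition gsqr (f : grid R) : grid R := fun i j => f i j ^+ 2.
End Pointwise.

Notation "f +^ g" := (gadd f g) (at level 50, left associativity).
Notation "f -^ g" := (gsub f g) (at level 50, left associativity).
Notation "f *^ g" := (gmul f g) (at level 40, left associativity).
Notation "a :*^ f" := (gscale a f) (at level 40, left associativity).

(* Rey is the Reynolds number Re; dt is the time step, h the mesh size, m1 x m2
   the number of cells. *)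
Record params (R : Type) := Params {
  M : R; Rey : R; We : R; Fr : R; Pe : R; eta : R; eps : R;
  rho1 : R; rho2 : R; mu1 : R; mu2 : R;
  dt : R; h : R; m1 : nat; m2 : nat }.

(* (utilde, vtilde) is the intermediate velocity, mubar and pres are the
   variables written with a bar. *)
Record level (R : Type) := Level {
  conc : cell R; mubar : cell R; pres : cell R;
  utilde : ew_edge R; vtilde : ns_edge R;
  uvel : ew_edge R; vvel : ns_edge R }.

Section Scheme.
Variables (R : rcfType) (P : params R).

Local Notation h := (h P).
Local Notation dt := (dt P).
Local Notation m1 := (m1 P).
Local Notation m2 := (m2 P).
Local Notation rho1 := (rho1 P).
Local Notation rho2 := (rho2 P).
Local Notation mu1 := (mu1 P).
Local Notation mu2 := (mu2 P).
Local Notation eps := (eps P).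
Local Notation eta := (eta P).
Local Notation M := (M P).
Local Notation Rey := (Rey P).
Local Notation We := (We P).
Local Notation Fr := (Fr P).
Local Notation Pe := (Pe P).

Definition params_pos : Prop :=
  [/\ [/\ 0 < M, 0 < Rey, 0 < We, 0 < Fr & 0 < Pe],
      [/\ 0 < eta, 0 < eps, 0 < dt & 0 < h],
      [/\ 0 < rho1, 0 < rho2, 0 < mu1 & 0 < mu2],
      (0 < m1)%N & (0 < m2)%N].

Definition Lx : R := m1%:R * h.
Definition Ly : R := m2%:R * h.

Definition alpha : R := (rho2 - rho1) / (rho1 * rho2).
Definition rho (c : R) : R := rho1 * rho2 / ((rho2 - rho1) * c + rho1).
Definition mu (c : R) : R := mu1 * mu2 / ((mu2 - mu1) * c + mu1).
Definition mob (c : R) : R := Num.sqrt (c ^+ 2 * (1 - c) ^+ 2 + eps).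
Definition F (c : R) : R := c ^+ 2 * (c - 1) ^+ 2 / 4.
Definition g (a b : R) : R :=
  4^-1 * (a * (a - 1) + b * (b - 1)) * (a + b - 1).
Definition r (a b : R) : R := - alpha * rho a * rho b.

Definition on_grid (f : R -> R) (c : cell R) : cell R := fun i j => f (c i j).

Definition admissible (c : cell R) : Prop :=
  forall i j, (i <= m1.+1)%N -> (j <= m2.+1)%N ->
    0 < (rho2 - rho1) * c i j + rho1 /\ 0 < (mu2 - mu1) * c i j + mu1.

Definition ycell : cell R := fun i j => (j%:R - 2^-1) * h.

Definition ax (u : ew_edge R) : cell R := fun i j => (u i j + u i.-1 j) / 2.
Definition dx (u : ew_edge R) : cell R := fun i j => (u i j - u i.-1 j) / h.
Definition ay (v : ns_edge R) : cell R := fun i j => (v i j + v i j.-1) / 2.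
Definition dy (v : ns_edge R) : cell R := fun i j => (v i j - v i j.-1) / h.

Definition Ax (f : cell R) : ew_edge R := fun i j => (f i.+1 j + f i j) / 2.
Definition Dx (f : cell R) : ew_edge R := fun i j => (f i.+1 j - f i j) / h.
Definition Ay (f : cell R) : ns_edge R := fun i j => (f i j.+1 + f i j) / 2.
Definition Dy (f : cell R) : ns_edge R := fun i j => (f i j.+1 - f i j) / h.

Definition cA (f : cell R) : vertex R :=
  fun i j => (f i.+1 j.+1 + f i j.+1 + f i.+1 j + f i j) / 4.

Definition cAx (v : ns_edge R) : vertex R :=
  fun i j => (v i.+1 j + v i j) / 2.
Definition cDx (v : ns_edge R) : vertex R :=
  fun i j => (v i.+1 j - v i j) / h.
Definition cAy (u : ew_edge R) : vertex R :=
  fun i j => (u i j.+1 + u i j) / 2.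
Definition cDy (u : ew_edge R) : vertex R :=
  fun i j => (u i j.+1 - u i j) / h.

Definition fAx (f : vertex R) : ns_edge R := fun i j => (f i j + f i.-1 j) / 2.
Definition fDx (f : vertex R) : ns_edge R := fun i j => (f i j - f i.-1 j) / h.
Definition fAy (f : vertex R) : ew_edge R := fun i j => (f i j + f i j.-1) / 2.
Definition fDy (f : vertex R) : ew_edge R := fun i j => (f i j - f i j.-1) / h.

Definition vbar (f : vertex R) : cell R :=
  fun i j => (f i j + f i.-1 j + f i j.-1 + f i.-1 j.-1) / 4.

(* a_x(rho_ew D_x c u) and a_y(rho_ns D_y c v) *)
Definition adv_x (rh c : cell R) (u : ew_edge R) : cell R :=
  fun i j => (rh i.+1 j * Dx c i j * u i j
              + rh i.-1 j * Dx c i.-1 j * u i.-1 j) / 2.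
Definition adv_y (rh c : cell R) (v : ns_edge R) : cell R :=
  fun i j => (rh i j.+1 * Dy c i j * v i j
              + rh i j.-1 * Dy c i j.-1 * v i j.-1) / 2.

(* A_x(rho_ew mubar) and A_y(rho_ns mubar) *)
Definition Ax_ew (rh mb : cell R) : ew_edge R :=
  fun i j => (rh i.+1 j * mb i j + rh i j * mb i.+1 j) / 2.
Definition Ay_ns (rh mb : cell R) : ns_edge R :=
  fun i j => (rh i j.+1 * mb i j + rh i j * mb i j.+1) / 2.

(* |grad_D c|^2 *)
Definition sqgrad (c : cell R) : cell R :=
  ax (gsqr (Dx c)) +^ ay (gsqr (Dy c)).

(* The superscript n + 1/2, from the values at levels n + 1 and n. *)
Definition half (f1 f0 : cell R) : cell R := 2^-1 :*^ (f1 +^ f0).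

Definition inner (f k : cell R) : R :=
  \sum_(1 <= i < m1.+1) \sum_(1 <= j < m2.+1) f i j * k i j.

(* In the norm2_* below, phi is the weight whose square root appears in
   ||sqrt(phi) ...||_2^2. *)
Definition norm2_vel (phi : cell R) (u : ew_edge R) (v : ns_edge R) : R :=
  h ^+ 2 * inner phi (ax (gsqr u)) + h ^+ 2 * inner phi (ay (gsqr v)).

Definition norm2_gradD (phi psi : cell R) : R :=
  h ^+ 2 * inner phi (ax (gsqr (Dx psi)))
  + h ^+ 2 * inner phi (ay (gsqr (Dy psi))).

Definition norm2_gradd (phi : cell R) (u : ew_edge R) (v : ns_edge R) : R :=
  h ^+ 2 * inner phi (gsqr (dx u))
  + h ^+ 2 * inner phi (vbar (gsqr (cDy u)))
  + h ^+ 2 * inner phi (vbar (gsqr (cDx v)))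
  + h ^+ 2 * inner phi (gsqr (dy v)).

Definition norm2_divd (phi : cell R) (u : ew_edge R) (v : ns_edge R) : R :=
  h ^+ 2 * inner phi (gsqr (dx u +^ dy v)).

Definition rhoL (s : level R) : cell R := on_grid rho (conc s).
Definition muL (s : level R) : cell R := on_grid mu (conc s).
Definition mobL (s : level R) : cell R := on_grid mob (conc s).
Definition FL (s : level R) : cell R := on_grid F (conc s).

(* The chemical potential mu_c = mubar_c + alpha pbar. *)
Definition chem (s : level R) : cell R := mubar s +^ alpha :*^ pres s.

Definition energy (s : level R) : R :=
  2^-1 * norm2_vel (rhoL s) (uvel s) (vvel s)
  + eps * eta / (2 * We) * norm2_gradD (rhoL s) (conc s)
  + eta * h ^+ 2 / (eps * We) * inner (rhoL s *^ FL s) (fun _ _ => 1)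
  + h ^+ 2 / Fr * inner (rhoL s *^ ycell) (fun _ _ => 1).

(* In J1-J7, s0 is the data at level n and s1 the data at level n + 1. *)
Definition J1 (s0 s1 : level R) : Prop :=
  let rh0 := rhoL s0 in let rh1 := rhoL s1 in let vis := muL s0 in
  let u0 := uvel s0 in let v0 := vvel s0 in
  let ut := utilde s1 in let vt := vtilde s1 in
  forall i j, (1 <= i < m1)%N -> (1 <= j <= m2)%N ->
    Ax rh0 i j * ((ut i j - u0 i j) / dt)
    + Ax (rh0 *^ ax u0 *^ dx ut) i j
    + fAy (cA rh0 *^ cAx v0 *^ cDy ut) i j
    + 2^-1 * ut i j * ((Ax rh1 i j - Ax rh0 i j) / dt
                       + Dx (rh0 *^ ax u0) i j
                       + fDy (cA rh0 *^ cAx v0) i j)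
    = Rey^-1 * (Dx (vis *^ dx ut) i j + fDy (cA vis *^ cDy ut) i j)
      + (3 * Rey)^-1 * Dx (vis *^ (dx ut +^ dy vt)) i j.

Definition J2 (s0 s1 : level R) : Prop :=
  let rh0 := rhoL s0 in let rh1 := rhoL s1 in let vis := muL s0 in
  let u0 := uvel s0 in let v0 := vvel s0 in
  let ut := utilde s1 in let vt := vtilde s1 in
  forall i j, (1 <= i <= m1)%N -> (1 <= j < m2)%N ->
    Ay rh0 i j * ((vt i j - v0 i j) / dt)
    + fAx (cA rh0 *^ cAy u0 *^ cDx vt) i j
    + Ay (rh0 *^ ay v0 *^ dy vt) i j
    + 2^-1 * vt i j * ((Ay rh1 i j - Ay rh0 i j) / dt
                       + fDx (cA rh0 *^ cAy u0) i j
                       + Dy (rh0 *^ ay v0) i j)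
    = Rey^-1 * (fDx (cA vis *^ cDx vt) i j + Dy (vis *^ dy vt) i j)
      + (3 * Rey)^-1 * Dy (vis *^ (dx ut +^ dy vt)) i j.

Definition J3 (s1 : level R) : Prop :=
  forall i j, (1 <= i < m1)%N -> (1 <= j <= m2)%N ->
    Ax (rhoL s1) i j * ((uvel s1 i j - utilde s1 i j) / dt)
    = - M^-1 * Dx (pres s1) i j
      + M^-1 * Ax_ew (rhoL s1) (mubar s1) i j * Dx (conc s1) i j.

Definition J4 (s1 : level R) : Prop :=
  forall i j, (1 <= i <= m1)%N -> (1 <= j < m2)%N ->
    Ay (rhoL s1) i j * ((vvel s1 i j - vtilde s1 i j) / dt)
    = - M^-1 * Dy (pres s1) i j
      + M^-1 * Ay_ns (rhoL s1) (mubar s1) i j * Dy (conc s1) i j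
      - Fr^-1 * Ay (rhoL s1) i j.

Definition Q (s0 s1 : level R) : cell R := fun i j =>
  Pe^-1 * (dx (Ax (mobL s0) *^ Dx (mubar s1)) i j
           + dy (Ay (mobL s0) *^ Dy (mubar s1)) i j)
  + alpha / Pe * (dx (Ax (mobL s0) *^ Dx (pres s1)) i j
                  + dy (Ay (mobL s0) *^ Dy (pres s1)) i j).

Definition J5 (s0 s1 : level R) : Prop :=
  forall i j, (1 <= i <= m1)%N -> (1 <= j <= m2)%N ->
    dx (uvel s1) i j + dy (vvel s1) i j = alpha * Q s0 s1 i j.

Definition J6 (s0 s1 : level R) : Prop :=
  forall i j, (1 <= i <= m1)%N -> (1 <= j <= m2)%N ->
    rhoL s0 i j * ((conc s1 i j - conc s0 i j) / dt)
    + adv_x (rhoL s1) (conc s1) (uvel s1) i j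
    + adv_y (rhoL s1) (conc s1) (vvel s1) i j
    = Q s0 s1 i j.

Definition J7 (s0 s1 : level R) : Prop :=
  let c0 := conc s0 in let c1 := conc s1 in
  let rhh := half (rhoL s1) (rhoL s0) in
  forall i j, (1 <= i <= m1)%N -> (1 <= j <= m2)%N ->
    rhoL s0 i j * mubar s1 i j
    = M * eta / (eps * We) * rhh i j * g (c1 i j) (c0 i j)
      + M * eta / (eps * We) * half (FL s1) (FL s0) i j * r (c1 i j) (c0 i j)
      + eps * eta * M / (2 * We)
        * half (sqgrad c1) (sqgrad c0) i j * r (c1 i j) (c0 i j)
      - eps * eta * M / We * (dx (Ax rhh *^ Dx (half c1 c0)) i j
                              + dy (Ay rhh *^ Dy (half c1 c0)) i j).

Definition scheme (s0 s1 : level R) : Prop :=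
  [/\ [/\ J1 s0 s1, J2 s0 s1, J3 s1 & J4 s1],
      J5 s0 s1, J6 s0 s1 & J7 s0 s1].

Definition neumann (f : cell R) : Prop :=
  (forall j, (1 <= j <= m2)%N -> f 0%N j = f 1%N j /\ f m1.+1 j = f m1 j) /\
  (forall i, (1 <= i <= m1)%N -> f i 0%N = f i 1%N /\ f i m2.+1 = f i m2).

Definition no_slip (ut : ew_edge R) (vt : ns_edge R) : Prop :=
  [/\ forall j, (1 <= j <= m2)%N -> ut 0%N j = 0 /\ ut m1 j = 0,
      forall i, (i <= m1)%N ->
        2^-1 * (ut i 0%N + ut i 1%N) = 0 /\ 2^-1 * (ut i m2 + ut i m2.+1) = 0,
      forall i, (1 <= i <= m1)%N -> vt i 0%N = 0 /\ vt i m2 = 0 &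
      forall j, (j <= m2)%N ->
        2^-1 * (vt 0%N j + vt 1%N j) = 0 /\ 2^-1 * (vt m1 j + vt m1.+1 j) = 0].

Definition no_penetration (u : ew_edge R) (v : ns_edge R) : Prop :=
  (forall j, (1 <= j <= m2)%N -> u 0%N j = 0 /\ u m1 j = 0) /\
  (forall i, (1 <= i <= m1)%N -> v i 0%N = 0 /\ v i m2 = 0).

Definition boundary_conditions (s : level R) : Prop :=
  [/\ neumann (conc s), neumann (chem s),
      no_slip (utilde s) (vtilde s) & no_penetration (uvel s) (vvel s)].

End Scheme.

(* Main.v *)
Require Import Defs.
From mathcomp Require Import all_boot all_order all_algebra.
From mathcomp Require Import ring.

Set Implicit Arguments.
Unset Strict Implicit.
Unset Printing Implicit Defensive.

Import Order.TTheory GRing.Theory Num.Theory.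
Local Open Scope ring_scope.

(** Energy is moved around by the scheme, and every transfer is an exact
    summation by parts; what is left over is a sum of squares.

    Testing the two momentum equations with the intermediate velocity, and the
    two projection equations with the new velocity, produces the change of
    kinetic energy: since b (b - a) = (b^2 - a^2 + (b - a)^2) / 2, the time
    differences also leave the squares of the two velocity increments.  The
    convective terms cancel because they are discretized in skew-symmetric form
    ([convection_x], [convection_y]); the viscous terms give the two viscous
    norms ([viscous_x], [viscous_y], [viscous_divergence]).  See [momentum_x],
    [momentum_y], [projection_x] and [projection_y].

    The projection step leaves the work of the pressure and of the surface
    tension.  The two averages of rho times a field, one in the surface tension
    and one in the advection of c, are adjoint to each other ([inner_adv_x],
    [inner_adv_y]), so that the divergence constraint and the equation of c turn
    this work into the pairing of the chemical potential with Q, minus the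
    pairing of rho^n mubar with the increment of c ([work_balance]).  The first
    is the diffusive dissipation ([chem_dissipation]).  The second is the
    increment of the free energy ([free_energy_balance]), because g and r are the
    divided differences of F and rho.

    Finally the constraint and the equation of c together imply an exact
    discrete continuity equation, again because r is the divided difference of
    rho ([density_balance]); tested with y it identifies the work of gravity
    with the increment of potential energy ([mass_balance]).  Adding up these
    balances gives the energy law, and its right-hand side is nonpositive because
    rho, mu and the mobility are nonnegative. *)

(** * Summation by parts on the staggered grid *)

(** All summations by parts between cells and edges come from this one: a sum
    over cells of values on their two edges is rearranged by edge, and the two
    wall edges contribute nothing. *)
Lemma sum_edge_regroup (R : comPzRingType) (m : nat) (a b u : nat -> R) :
  (0 < m)%N -> u 0%N = 0 -> u m = 0 ->
  \sum_(1 <= i < m.+1) (a i * u i + b i * u i.-1)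
    = \sum_(1 <= i < m) (a i + b i.+1) * u i.
Proof.
case: m => // m _ u0 um.
rewrite big_split /= big_nat_recr //= um mulr0 addr0.
rewrite [X in _ + X]big_nat_recl //= u0 mulr0 add0r.
by rewrite -big_split /=; apply: eq_bigr => i _; rewrite mulrDl.
Qed.

Lemma sum_telescope_pred (R : pzRingType) (m : nat) (f : nat -> R) :
  \sum_(1 <= i < m.+1) (f i - f i.-1) = f m - f 0%N.
Proof. by rewrite big_add1 /= telescope_sumr. Qed.

Section Grid.
Variables (R : rcfType) (P : params R).
Local Notation h := (h P).
Local Notation m1 := (m1 P).
Local Notation m2 := (m2 P).
Hypotheses (m1_gt0 : (0 < m1)%N) (m2_gt0 : (0 < m2)%N) (h_neq0 : h != 0).

(** Only interior edges are summed: the equations hold there, and velocities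
    vanish on the walls. *)
Definition ew_sum (f : ew_edge R) : R :=
  \sum_(1 <= i < m1) \sum_(1 <= j < m2.+1) f i j.
Definition ns_sum (f : ns_edge R) : R :=
  \sum_(1 <= i < m1.+1) \sum_(1 <= j < m2) f i j.
Definition cell_sum (f : cell R) : R :=
  \sum_(1 <= i < m1.+1) \sum_(1 <= j < m2.+1) f i j.

Definition ew_wall0 (u : ew_edge R) : Prop :=
  forall j, (1 <= j <= m2)%N -> u 0%N j = 0 /\ u m1 j = 0.
Definition ns_wall0 (v : ns_edge R) : Prop :=
  forall i, (1 <= i <= m1)%N -> v i 0%N = 0 /\ v i m2 = 0.

Lemma ew_wall0_mul (f u : ew_edge R) : ew_wall0 u -> ew_wall0 (f *^ u).
Proof. by move=> w j /w[e1 e2]; rewrite /gmul e1 e2 !mulr0. Qed.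

Lemma ns_wall0_mul (f u : ns_edge R) : ns_wall0 u -> ns_wall0 (f *^ u).
Proof. by move=> w j /w[e1 e2]; rewrite /gmul e1 e2 !mulr0. Qed.

Lemma ew_wall0_sqr (u : ew_edge R) : ew_wall0 u -> ew_wall0 (gsqr u).
Proof. by move=> w j /w[e1 e2]; rewrite /gsqr e1 e2 expr0n. Qed.

Lemma ns_wall0_sqr (u : ns_edge R) : ns_wall0 u -> ns_wall0 (gsqr u).
Proof. by move=> w j /w[e1 e2]; rewrite /gsqr e1 e2 expr0n. Qed.

Lemma ew_wall0_sub (u v : ew_edge R) :
  ew_wall0 u -> ew_wall0 v -> ew_wall0 (u -^ v).
Proof.
move=> hu hv j hj; have [a b] := hu j hj; have [c d] := hv j hj.
by rewrite /gsub a b c d subrr.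
Qed.

Lemma ns_wall0_sub (u v : ns_edge R) :
  ns_wall0 u -> ns_wall0 v -> ns_wall0 (u -^ v).
Proof.
move=> hu hv j hj; have [a b] := hu j hj; have [c d] := hv j hj.
by rewrite /gsub a b c d subrr.
Qed.

Lemma eq_cell_sum (f k : cell R) :
  (forall i j, (1 <= i <= m1)%N -> (1 <= j <= m2)%N -> f i j = k i j) ->
  cell_sum f = cell_sum k.
Proof. by move=> e; apply: eq_big_nat => i hi; apply: eq_big_nat => j; apply: e. Qed.

Lemma eq_ew_sum (f k : ew_edge R) :
  (forall i j, (1 <= i < m1)%N -> (1 <= j <= m2)%N -> f i j = k i j) ->
  ew_sum f = ew_sum k.
Proof. by move=> e; apply: eq_big_nat => i hi; apply: eq_big_nat => j; apply: e. Qed.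

Lemma eq_ns_sum (f k : ns_edge R) :
  (forall i j, (1 <= i <= m1)%N -> (1 <= j < m2)%N -> f i j = k i j) ->
  ns_sum f = ns_sum k.
Proof. by move=> e; apply: eq_big_nat => i hi; apply: eq_big_nat => j; apply: e. Qed.

Lemma cell_sumD (f k : cell R) : cell_sum (f +^ k) = cell_sum f + cell_sum k.
Proof. by rewrite /cell_sum -big_split; apply: eq_bigr => i _; rewrite -big_split. Qed.

Lemma cell_sumZ a (f : cell R) : cell_sum (a :*^ f) = a * cell_sum f.
Proof. by rewrite /cell_sum mulr_sumr; apply: eq_bigr => i _; rewrite mulr_sumr. Qed.

Lemma ew_sumD (f k : cell R) : ew_sum (f +^ k) = ew_sum f + ew_sum k.
Proof. by rewrite /ew_sum -big_split; apply: eq_bigr => i _; rewrite -big_split. Qed.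

Lemma ew_sumZ a (f : cell R) : ew_sum (a :*^ f) = a * ew_sum f.
Proof. by rewrite /ew_sum mulr_sumr; apply: eq_bigr => i _; rewrite mulr_sumr. Qed.

Lemma ns_sumD (f k : cell R) : ns_sum (f +^ k) = ns_sum f + ns_sum k.
Proof. by rewrite /ns_sum -big_split; apply: eq_bigr => i _; rewrite -big_split. Qed.

Lemma ns_sumZ a (f : cell R) : ns_sum (a :*^ f) = a * ns_sum f.
Proof. by rewrite /ns_sum mulr_sumr; apply: eq_bigr => i _; rewrite mulr_sumr. Qed.

Lemma ew_regroup (a b : cell R) (u : ew_edge R) :
  ew_wall0 u ->
  cell_sum (fun i j => a i j * u i j + b i j * u i.-1 j)
    = ew_sum (fun i j => (a i j + b i.+1 j) * u i j).
Proof.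
move=> hu; rewrite /cell_sum /ew_sum exchange_big [RHS]exchange_big /=.
apply: eq_big_nat => j /hu [u0 um].
exact: (sum_edge_regroup (fun i => a i j) (fun i => b i j) (u := fun i => u i j)).
Qed.

Lemma ns_regroup (a b : cell R) (v : ns_edge R) :
  ns_wall0 v ->
  cell_sum (fun i j => a i j * v i j + b i j * v i j.-1)
    = ns_sum (fun i j => (a i j + b i j.+1) * v i j).
Proof.
move=> hv; apply: eq_big_nat => i /hv [v0 vm].
exact: (sum_edge_regroup (a i) (b i) (u := v i)).
Qed.

Lemma inner_ax (f : cell R) u : ew_wall0 u ->
  inner P f (ax u) = ew_sum (Ax f *^ u).
Proof.
move=> hu; transitivity (cell_sum (fun i j => f i j / 2 * u i j + f i j / 2 * u i.-1 j)).
  by apply: eq_cell_sum => i j _ _; rewrite /ax; field.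
by rewrite ew_regroup //; apply: eq_ew_sum => i j _ _; rewrite /gmul /Ax; field.
Qed.

Lemma inner_dx (f : cell R) u : ew_wall0 u ->
  inner P f (dx P u) = - ew_sum (Dx P f *^ u).
Proof.
move=> hu; transitivity (cell_sum (fun i j =>
    f i j / h * u i j + (- (f i j / h)) * u i.-1 j)).
  by apply: eq_cell_sum => i j _ _; rewrite /dx; ring.
rewrite ew_regroup // -mulN1r -ew_sumZ; apply: eq_ew_sum => i j _ _.
by rewrite /gscale /gmul /Dx; ring.
Qed.

Lemma inner_ay (f : cell R) v : ns_wall0 v ->
  inner P f (ay v) = ns_sum (Ay f *^ v).
Proof.
move=> hv; transitivity (cell_sum (fun i j => f i j / 2 * v i j + f i j / 2 * v i j.-1)).
  by apply: eq_cell_sum => i j _ _; rewrite /ay; field.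
by rewrite ns_regroup //; apply: eq_ns_sum => i j _ _; rewrite /gmul /Ay; field.
Qed.

Lemma inner_dy (f : cell R) v : ns_wall0 v ->
  inner P f (dy P v) = - ns_sum (Dy P f *^ v).
Proof.
move=> hv; transitivity (cell_sum (fun i j =>
    f i j / h * v i j + (- (f i j / h)) * v i j.-1)).
  by apply: eq_cell_sum => i j _ _; rewrite /dy; ring.
rewrite ns_regroup // -mulN1r -ns_sumZ; apply: eq_ns_sum => i j _ _.
by rewrite /gscale /gmul /Dy; ring.
Qed.

(** The averages in the advection of c and in the surface tension use the
    density of the opposite cell exactly so that they are adjoint. *)
Lemma inner_adv_x (f rh c : cell R) u : ew_wall0 u ->
  inner P f (adv_x P rh c u) = ew_sum (Ax_ew rh f *^ Dx P c *^ u).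
Proof.
move=> hu; transitivity (cell_sum (fun i j =>
    f i j * rh i.+1 j * Dx P c i j / 2 * u i j
    + f i j * rh i.-1 j * Dx P c i.-1 j / 2 * u i.-1 j)).
  by apply: eq_cell_sum => i j _ _; rewrite /adv_x; field.
by rewrite ew_regroup //; apply: eq_ew_sum => i j _ _; rewrite /gmul /Ax_ew /=; field.
Qed.

Lemma inner_adv_y (f rh c : cell R) v : ns_wall0 v ->
  inner P f (adv_y P rh c v) = ns_sum (Ay_ns rh f *^ Dy P c *^ v).
Proof.
move=> hv; transitivity (cell_sum (fun i j =>
    f i j * rh i j.+1 * Dy P c i j / 2 * v i j
    + f i j * rh i j.-1 * Dy P c i j.-1 / 2 * v i j.-1)).
  by apply: eq_cell_sum => i j _ _; rewrite /adv_y; field.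
by rewrite ns_regroup //; apply: eq_ns_sum => i j _ _; rewrite /gmul /Ay_ns /=; field.
Qed.

(** Used to compare two sums with the same bulk and different distributions over
    neighbours: the difference is a discrete derivative of a flux k. *)
Lemma ew_sum_telescope (f k : ew_edge R) :
  (forall i, (1 <= i < m1)%N -> k i 0%N = k i m2) ->
  (forall i j, (1 <= i < m1)%N -> (1 <= j <= m2)%N -> f i j = k i j - k i j.-1) ->
  ew_sum f = 0.
Proof.
move=> hk hf; apply: big1_seq => i; rewrite mem_index_iota => /= hi.
under eq_big_nat => j hj do rewrite hf //.
by rewrite sum_telescope_pred hk // subrr.
Qed.

(** Half the advective form plus half the conservative form is skew-symmetric:
    u_i times the bracket is half the difference of
    f_(i+1) u_i u_(i+1) and f_i u_(i-1) u_i, divided by h. *)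
Lemma convection_x (f : cell R) u : ew_wall0 u ->
  ew_sum (fun i j => u i j * (Ax (f *^ dx P u) i j + 2^-1 * u i j * Dx P f i j)) = 0.
Proof.
move=> hu; transitivity (ew_sum (fun i j =>
   (- (f i j * u i.-1 j / h / 2) + f i.+1 j * u i.+1 j / h / 2) * u i j)).
  apply: eq_ew_sum => i j _ _; rewrite /gmul /Ax /Dx /dx /=; ring.
(* Seen from the cells, the flux f_i u_(i-1) u_i is counted once from each of
   the two edges of cell i, with opposite signs. *)
rewrite -(ew_regroup (fun i j => - (f i j * u i.-1 j / h / 2))
  (fun i j => f i j * u i j / h / 2)) //.
rewrite [LHS]big1 // => i _; rewrite big1 // => j _; ring.
Qed.

(** The same cancellation across rows; here it is the mass flux f that vanishes at
    the walls. *)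
Lemma convection_y (f : vertex R) u :
  (forall i, (1 <= i < m1)%N -> f i 0%N = 0 /\ f i m2 = 0) ->
  ew_sum (fun i j => u i j * (fAy (f *^ cDy P u) i j + 2^-1 * u i j * fDy P f i j)) = 0.
Proof.
move=> hf.
apply: (ew_sum_telescope (k := fun i j => f i j * u i j * u i j.+1 / h / 2)).
  by move=> i /hf [-> ->]; rewrite !mul0r.
by move=> i [|j] // _ _; rewrite /gmul /fAy /fDy /cDy /=; ring.
Qed.

Lemma viscous_x (f : cell R) u : ew_wall0 u ->
  ew_sum (Dx P (f *^ dx P u) *^ u) = - inner P f (gsqr (dx P u)).
Proof.
move=> hu; rewrite -[LHS]opprK -inner_dx //; congr (- _).
by apply: eq_cell_sum => i j _ _; rewrite /gmul /gsqr; ring.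
Qed.

(** The weight collected by a vertex on a horizontal wall is half of cA f: it has
    only two neighbouring cells, and by the Neumann condition cA f is their mean.
    This is the weight that fAy gives to it as well. *)
Lemma inner_vbar (f : cell R) (w : vertex R) :
  (forall j, (j <= m2)%N -> w 0%N j = 0 /\ w m1 j = 0) ->
  (forall i, (1 <= i <= m1)%N -> f i 0%N = f i 1%N /\ f i m2.+1 = f i m2) ->
  inner P f (vbar w) = ew_sum (fAy (cA f *^ w)).
Proof.
move=> hw hf.
pose W : ew_edge R := fun i j => (w i j + w i j.-1) / 2.
have hW : ew_wall0 W.
  move=> j /andP[_ jm]; rewrite /W.
  have [-> ->] := hw _ jm; have [-> ->] := hw _ (leq_trans (leq_pred j) jm).
  by rewrite addr0 mul0r.
transitivity (inner P f (ax W)).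
  by apply: eq_cell_sum => i j _ _; rewrite /vbar /ax /W; field.
rewrite inner_ax //; apply/eqP; rewrite -subr_eq0 -mulN1r -ew_sumZ -ew_sumD; apply/eqP.
(* The flux is proportional to the normal difference of f, zero at the walls. *)
apply: (ew_sum_telescope (k := fun i j => - (Ax f i j.+1 - Ax f i j) / 4 * w i j)).
  move=> i /andP[i1 im].
  have [e1 e2] := hf i (introT andP (conj i1 (ltnW im))).
  have [e3 e4] := hf i.+1 im.
  by rewrite /Ax e1 e2 e3 e4 !subrr oppr0 !mul0r.
by move=> i [|j] // _ _; rewrite /gadd /gscale /gmul /Ax /W /fAy /cA /=; field.
Qed.

(** With no-slip through ghost values, u at the first row equals half the jump
    across the wall, so the boundary terms of the summation by parts are squares
    that enter the norm with the half weight of [inner_vbar]. *)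
Lemma viscous_y (f : cell R) u :
  ew_wall0 u ->
  (forall i, (i <= m1)%N -> u i 0%N + u i 1%N = 0 /\ u i m2 + u i m2.+1 = 0) ->
  (forall i, (1 <= i <= m1)%N -> f i 0%N = f i 1%N /\ f i m2.+1 = f i m2) ->
  ew_sum (fDy P (cA f *^ cDy P u) *^ u) = - inner P f (vbar (gsqr (cDy P u))).
Proof.
move=> hu hg hf; rewrite inner_vbar //; last first.
  (* The corner ghost values are zero as well. *)
  have u0 j : (j <= m2.+1)%N -> u 0%N j = 0 /\ u m1 j = 0.
    case: j => [|j].
      move=> _; have [u01 um1] := hu 1%N m2_gt0.
      have [+ _] := hg 0%N isT; have [+ _] := hg m1 (leqnn _).
      by rewrite u01 um1 !addr0.
    rewrite leq_eqVlt => /orP[/eqP[->]|jm]; last exact: hu.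
    have [u01 um1] := hu m2 (introT andP (conj m2_gt0 (leqnn _))).
    have [_ +] := hg 0%N isT; have [_ +] := hg m1 (leqnn _).
    by rewrite u01 um1 !add0r.
  move=> j jm; rewrite /gsqr /cDy.
  have [-> ->] := u0 _ (leqW jm); have [-> ->] := u0 j.+1 jm.
  by rewrite subrr mul0r expr0n.
apply/eqP; rewrite -subr_eq0 opprK -ew_sumD; apply/eqP.
(* The telescoping flux carries the vertex average of u, which no-slip kills
   at both walls. *)
apply: (ew_sum_telescope
  (k := fun i j => cA f i j * cDy P u i j * (u i j + u i j.+1) / h / 2)).
  by move=> i /andP[_ /ltnW im]; have [-> ->] := hg i im; rewrite !mulr0 !mul0r.
move=> i [|j] // _ _; rewrite /gadd /gmul /fAy /fDy /cDy /gsqr /=; field.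
exact: h_neq0.
Qed.
(** The grad-div part of the stress dissipates only when both components of the
    momentum equation are added. *)
Lemma viscous_divergence (f : cell R) (u : ew_edge R) (v : ns_edge R) :
  ew_wall0 u -> ns_wall0 v ->
  ew_sum (Dx P (f *^ (dx P u +^ dy P v)) *^ u)
  + ns_sum (Dy P (f *^ (dx P u +^ dy P v)) *^ v)
  = - inner P f (gsqr (dx P u +^ dy P v)).
Proof.
move=> hu hv.
rewrite -[ew_sum _]opprK -[ns_sum _]opprK -inner_dx // -inner_dy // -opprD.
congr (- _); rewrite /inner -!/(cell_sum (_ *^ _)) -cell_sumD.
by apply: eq_cell_sum => i j _ _; rewrite /gmul /gadd /gsqr /gadd; ring.
Qed.
End Grid.

(** * The momentum equations *)

(** The term with the time derivative of rho in [J1] upgrades the weight of the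
    square of utilde from rho^n to rho^(n+1), as needed by the projection step. *)
Lemma momentum_x (R : rcfType) (P : params R) (s0 s1 : level R) :
  params_pos P -> boundary_conditions P s0 -> boundary_conditions P s1 ->
  J1 P s0 s1 ->
  2^-1 * ew_sum P (Ax (rhoL P s1) *^ gsqr (utilde s1))
  - 2^-1 * ew_sum P (Ax (rhoL P s0) *^ gsqr (uvel s0))
  + 2^-1 * ew_sum P (Ax (rhoL P s0) *^ gsqr (utilde s1 -^ uvel s0))
  = - (dt P / Rey P) * (inner P (muL P s0) (gsqr (dx P (utilde s1)))
                        + inner P (muL P s0) (vbar (gsqr (cDy P (utilde s1)))))
    + dt P / (3 * Rey P)
      * ew_sum P (Dx P (muL P s0 *^ (dx P (utilde s1) +^ dy P (vtilde s1)))
                  *^ utilde s1).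
Proof.
move=> [[_ Re0 _ _ _] [_ _ dt0 h0] _ m1_gt0 m2_gt0].
move=> [[_ nc] _ _ [_ v0w]] [_ _ [ut_w ut_g _ _] _] j1.
have h_neq0 := lt0r_neq0 h0; have dt_neq0 := lt0r_neq0 dt0; have Re_neq0 := lt0r_neq0 Re0.
have nvis i : (1 <= i <= m1 P)%N ->
    muL P s0 i 0%N = muL P s0 i 1%N /\ muL P s0 i (m2 P).+1 = muL P s0 i (m2 P).
  by move=> /nc[e1 e2]; rewrite /muL /on_grid e1 e2.
have ut_g' i : (i <= m1 P)%N ->
    utilde s1 i 0%N + utilde s1 i 1%N = 0
    /\ utilde s1 i (m2 P) + utilde s1 i (m2 P).+1 = 0.
  have n2 : 2^-1 != 0 :> R by rewrite invr_eq0 pnatr_eq0.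
  by move=> /ut_g[/eqP+ /eqP]; rewrite !mulf_eq0 !(negPf n2) => /eqP-> /eqP->.
have wall i : (1 <= i < m1 P)%N ->
    (cA (rhoL P s0) *^ cAx (vvel s0)) i 0%N = 0
    /\ (cA (rhoL P s0) *^ cAx (vvel s0)) i (m2 P) = 0.
  move=> /andP[i1 im]; rewrite /gmul /cAx.
  have [-> ->] := v0w i (introT andP (conj i1 (ltnW im))).
  by have [-> ->] := v0w i.+1 im; rewrite addr0 mul0r !mulr0.
have cx := convection_x m1_gt0 (rhoL P s0 *^ ax (uvel s0)) ut_w.
have cy := @convection_y _ P _ (utilde s1) wall.
set cvx := (X in ew_sum P X = 0) in cx; set cvy := (X in ew_sum P X = 0) in cy.
rewrite -[inner _ _ (gsqr _)]opprK -viscous_x //.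
rewrite -[inner _ _ (vbar _)]opprK -(viscous_y m1_gt0 m2_gt0 h_neq0) //.
(* Adding the vanishing convective sums makes the identity hold edge by edge:
   it is [J1] multiplied by dt * utilde. *)
rewrite -mulNr -opprD mulrNN mulrDr -[LHS]addr0 -[0](mulr0 (dt P)) -{1}[0]addr0.
rewrite -{1}cx -cy -!ew_sumD -!ew_sumZ -!ew_sumD; apply: eq_ew_sum => i j hi hj.
apply/eqP; rewrite -subr_eq0; apply/eqP.
have /eqP := j1 i j hi hj; rewrite -subr_eq0 => /eqP.
move/(congr1 (fun z => dt P * utilde s1 i j * z)); rewrite mulr0 => <-.
rewrite /cvx /cvy {wall cx cy cvx cvy} /gadd /gscale /gsqr /gsub /gmul; field.
by rewrite dt_neq0 Re_neq0.
Qed.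

(** The scheme is symmetric under exchange of the two axes; [swap_params] and
    [swap_level] carry out this exchange, which turns [J2] into [J1]. *)
Definition swap_params (R : rcfType) (P : params R) : params R :=
  Params (M P) (Rey P) (We P) (Fr P) (Pe P) (eta P) (eps P) (rho1 P) (rho2 P)
    (mu1 P) (mu2 P) (dt P) (h P) (m2 P) (m1 P).
Definition tr (R : Type) (f : grid R) : grid R := fun i j => f j i.
Definition swap_level (R : Type) (s : level R) : level R :=
  Level (tr (conc s)) (tr (mubar s)) (tr (pres s)) (tr (vtilde s))
    (tr (utilde s)) (tr (vvel s)) (tr (uvel s)).

Section Swap.
Variables (R : rcfType) (P : params R).
Lemma ew_sum_swap (f : grid R) : ew_sum (swap_params P) f = ns_sum P (tr f).
Proof. exact: exchange_big. Qed.

Lemma inner_swap (f k : grid R) : inner (swap_params P) f k = inner P (tr f) (tr k).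
Proof. exact: exchange_big. Qed.

Lemma swap_params_pos : params_pos P -> params_pos (swap_params P).
Proof. by case. Qed.

Lemma swap_bc s : boundary_conditions P s ->
  boundary_conditions (swap_params P) (swap_level s).
Proof. by case=> [[? ?] [? ?] [? ? ? ?] [? ?]]; split=> //; split. Qed.

Lemma swap_J2 s0 s1 :
  J2 P s0 s1 -> J1 (swap_params P) (swap_level s0) (swap_level s1).
Proof.
move=> j2 rh0 rh1 vis u0 v0 ut vt i j hi hj; have := j2 j i hj hi.
rewrite /u0 /v0 /ut /vt /=.
have -> : rh0 = tr (rhoL P s0) by [].
have -> : rh1 = tr (rhoL P s1) by [].
have -> : vis = tr (muL P s0) by [].
rewrite /fAy /fDy /fAx /fDx /gmul /cA /cAx /cAy /cDx /cDy /Ax /Ay /Dx /Dy.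
rewrite /gadd /ax /ay /dx /dy /tr /=.
move/eqP; rewrite -subr_eq0 => /eqP e; apply/eqP; rewrite -subr_eq0 -e.
by apply/eqP; ring.
Qed.
End Swap.

Lemma momentum_y (R : rcfType) (P : params R) (s0 s1 : level R) :
  params_pos P -> boundary_conditions P s0 -> boundary_conditions P s1 ->
  J2 P s0 s1 ->
  2^-1 * ns_sum P (Ay (rhoL P s1) *^ gsqr (vtilde s1))
  - 2^-1 * ns_sum P (Ay (rhoL P s0) *^ gsqr (vvel s0))
  + 2^-1 * ns_sum P (Ay (rhoL P s0) *^ gsqr (vtilde s1 -^ vvel s0))
  = - (dt P / Rey P) * (inner P (muL P s0) (gsqr (dy P (vtilde s1)))
                        + inner P (muL P s0) (vbar (gsqr (cDx P (vtilde s1)))))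
    + dt P / (3 * Rey P)
      * ns_sum P (Dy P (muL P s0 *^ (dx P (utilde s1) +^ dy P (vtilde s1)))
                  *^ vtilde s1).
Proof.
move=> /swap_params_pos hp /swap_bc b0 /swap_bc b1 /swap_J2 j.
have := momentum_x hp b0 b1 j; rewrite !ew_sum_swap !inner_swap /= => E.
(* Transposition matches everything by conversion, except for the order of the
   terms in the vertex average and in the divergence. *)
transitivity (- (dt P / Rey P) *
   (inner P (muL P s0) (tr (gsqr (dx (swap_params P) (tr (vtilde s1))))) +
    inner P (muL P s0) (tr (vbar (gsqr (cDy (swap_params P) (tr (vtilde s1))))))) +
   dt P / (3 * Rey P) *
   ns_sum P (tr (Dx (swap_params P)
     (muL (swap_params P) (swap_level s0)
      *^ (dx (swap_params P) (tr (vtilde s1))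
          +^ dy (swap_params P) (tr (utilde s1))))
     *^ tr (vtilde s1)))); first exact: E.
congr (_ * (_ + _) + _ * _).
- by apply: eq_cell_sum => i k _ _; rewrite /gmul /vbar /tr; ring.
- apply: eq_ns_sum => i k _ _; rewrite /Dx /Dy /gmul /gadd /tr /=.
  by rewrite ![dx (swap_params P) _ _ _ + _]addrC.
Qed.

(** * The projection step *)

Lemma projection_x (R : rcfType) (P : params R) (s : level R) :
  params_pos P -> no_penetration P (uvel s) (vvel s) -> J3 P s ->
  2^-1 * ew_sum P (Ax (rhoL P s) *^ gsqr (uvel s))
  - 2^-1 * ew_sum P (Ax (rhoL P s) *^ gsqr (utilde s))
  + 2^-1 * ew_sum P (Ax (rhoL P s) *^ gsqr (uvel s -^ utilde s))
  = dt P / M P * (inner P (pres s) (dx P (uvel s))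
                  + inner P (mubar s) (adv_x P (rhoL P s) (conc s) (uvel s))).
Proof.
move=> [[M0 _ _ _ _] [_ _ dt0 h0] _ m1_gt0 m2_gt0] [uw _] j3.
have M_neq0 := lt0r_neq0 M0; have dt_neq0 := lt0r_neq0 dt0.
rewrite inner_dx // inner_adv_x // -!mulNr -[- ew_sum _ _]mulN1r.
rewrite -!ew_sumZ -!ew_sumD -ew_sumZ.
apply: eq_ew_sum => i j hi hj.
apply/eqP; rewrite -subr_eq0; apply/eqP.
have /eqP := j3 i j hi hj; rewrite -subr_eq0 => /eqP.
move/(congr1 (fun z => dt P * uvel s i j * z)); rewrite mulr0 => <-.
rewrite /gadd /gscale /gsqr /gsub /gmul; field.
by rewrite dt_neq0 M_neq0.
Qed.

Lemma projection_y (R : rcfType) (P : params R) (s : level R) :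
  params_pos P -> no_penetration P (uvel s) (vvel s) -> J4 P s ->
  2^-1 * ns_sum P (Ay (rhoL P s) *^ gsqr (vvel s))
  - 2^-1 * ns_sum P (Ay (rhoL P s) *^ gsqr (vtilde s))
  + 2^-1 * ns_sum P (Ay (rhoL P s) *^ gsqr (vvel s -^ vtilde s))
  = dt P / M P * (inner P (pres s) (dy P (vvel s))
                  + inner P (mubar s) (adv_y P (rhoL P s) (conc s) (vvel s)))
    - dt P / Fr P * ns_sum P (Ay (rhoL P s) *^ vvel s).
Proof.
move=> [[M0 _ _ Fr0 _] [_ _ dt0 h0] _ m1_gt0 m2_gt0] [_ vw] j4.
have M_neq0 := lt0r_neq0 M0; have dt_neq0 := lt0r_neq0 dt0; have Fr_neq0 := lt0r_neq0 Fr0.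
rewrite inner_dy // inner_adv_y // -!mulNr -[- ns_sum _ _]mulN1r.
rewrite -!ns_sumZ -!ns_sumD -ns_sumZ -ns_sumD.
apply: eq_ns_sum => i j hi hj.
apply/eqP; rewrite -subr_eq0; apply/eqP.
have /eqP := j4 i j hi hj; rewrite -subr_eq0 => /eqP.
move/(congr1 (fun z => dt P * vvel s i j * z)); rewrite mulr0 => <-.
rewrite /gadd /gscale /gsqr /gsub /gmul; field.
by rewrite dt_neq0 M_neq0 Fr_neq0.
Qed.

(** * Diffusion and the gradient energy *)

Section Neumann.
Variables (R : rcfType) (P : params R).
Hypotheses (m1_gt0 : (0 < m1 P)%N) (m2_gt0 : (0 < m2 P)%N).

Lemma neumann_Dx f : neumann P f -> ew_wall0 P (Dx P f).
Proof. by move=> [n _] j /n[e1 e2]; rewrite /Dx e1 e2 !subrr mul0r. Qed.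

Lemma neumann_Dy f : neumann P f -> ns_wall0 P (Dy P f).
Proof. by move=> [_ n] j /n[e1 e2]; rewrite /Dy e1 e2 !subrr mul0r. Qed.

Lemma chem_dissipation s0 s1 : neumann P (chem P s1) ->
  inner P (chem P s1) (Q P s0 s1)
  = - (Pe P)^-1 * (inner P (mobL P s0) (ax (gsqr (Dx P (chem P s1))))
                   + inner P (mobL P s0) (ay (gsqr (Dy P (chem P s1))))).
Proof.
move=> n; have wx := neumann_Dx n; have wy := neumann_Dy n.
rewrite inner_ax ?inner_ay //; try by [exact: ew_wall0_sqr | exact: ns_wall0_sqr].
set c := chem P s1; set m := mobL P s0.
transitivity ((Pe P)^-1 * (inner P c (dx P (Ax m *^ Dx P c))
                          + inner P c (dy P (Ay m *^ Dy P c)))).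
  (* Q depends on mubar and pres only through their combination chem. *)
  rewrite -[_ + inner P c _]cell_sumD -[RHS]cell_sumZ; apply: eq_cell_sum => i j _ _.
  rewrite /gmul /gscale /gadd; transitivity (c i j * Q P s0 s1 i j) => //.
  by rewrite /Q /gmul /c /chem /gadd /gscale /dx /dy /Dx /Dy; ring.
rewrite inner_dx ?inner_dy //; try by [exact: ew_wall0_mul | exact: ns_wall0_mul].
rewrite -opprD mulrN mulNr; congr (- (_ * (_ + _))).
  by apply: eq_ew_sum => i j _ _; rewrite /gmul /gsqr; ring.
by apply: eq_ns_sum => i j _ _; rewrite /gmul /gsqr; ring.
Qed.

Lemma Dx_half (c1 c0 : cell R) i j :
  Dx P (Defs.half c1 c0) i j = 2^-1 * (Dx P c1 i j + Dx P c0 i j).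
Proof. by rewrite /Dx /Defs.half /gscale /gadd; ring. Qed.

Lemma Dy_half (c1 c0 : cell R) i j :
  Dy P (Defs.half c1 c0) i j = 2^-1 * (Dy P c1 i j + Dy P c0 i j).
Proof. by rewrite /Dy /Defs.half /gscale /gadd; ring. Qed.

(** The midpoint value makes the product of the mean and the increment of D_x c a
    difference of squares, with no remainder. *)
Lemma half_gradient_x (f c1 c0 : cell R) : neumann P c1 -> neumann P c0 ->
  inner P (c1 -^ c0) (dx P (Ax f *^ Dx P (Defs.half c1 c0)))
  = - 2^-1 * (inner P f (ax (gsqr (Dx P c1))) - inner P f (ax (gsqr (Dx P c0)))).
Proof.
move=> /neumann_Dx n1 /neumann_Dx n0.
have w : ew_wall0 P (Dx P (Defs.half c1 c0)).
  by move=> j hj; have [a0 b0] := n1 j hj; have [a1 b1] := n0 j hj;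
    rewrite !Dx_half a0 b0 a1 b1 addr0 mulr0.
rewrite !inner_ax //; try exact: ew_wall0_sqr.
rewrite inner_dx; [|by []|exact: ew_wall0_mul].
set X1 := ew_sum _ _; set X2 := ew_sum _ _; set X3 := ew_sum _ _.
suff -> : X1 = 2^-1 * X2 + - 2^-1 * X3 by ring.
rewrite /X1 /X2 /X3 -!ew_sumZ -ew_sumD; apply: eq_ew_sum => i j _ _.
by rewrite /gmul Dx_half /gsub /gscale /gadd /gsqr /gmul /Dx; ring.
Qed.

Lemma half_gradient_y (f c1 c0 : cell R) : neumann P c1 -> neumann P c0 ->
  inner P (c1 -^ c0) (dy P (Ay f *^ Dy P (Defs.half c1 c0)))
  = - 2^-1 * (inner P f (ay (gsqr (Dy P c1))) - inner P f (ay (gsqr (Dy P c0)))).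
Proof.
move=> /neumann_Dy n1 /neumann_Dy n0.
have w : ns_wall0 P (Dy P (Defs.half c1 c0)).
  by move=> j hj; have [a0 b0] := n1 j hj; have [a1 b1] := n0 j hj;
    rewrite !Dy_half a0 b0 a1 b1 addr0 mulr0.
rewrite !inner_ay //; try exact: ns_wall0_sqr.
rewrite inner_dy; [|by []|exact: ns_wall0_mul].
set X1 := ns_sum _ _; set X2 := ns_sum _ _; set X3 := ns_sum _ _.
suff -> : X1 = 2^-1 * X2 + - 2^-1 * X3 by ring.
rewrite /X1 /X2 /X3 -!ns_sumZ -ns_sumD; apply: eq_ns_sum => i j _ _.
by rewrite /gmul Dy_half /gsub /gscale /gadd /gsqr /gmul /Dy; ring.
Qed.

End Neumann.

(** * Free energy, density and potential energy *)

Section Balances.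
Variables (R : rcfType) (P : params R).
Hypothesis hpos : params_pos P.

Lemma r_secant a b :
  0 < (rho2 P - rho1 P) * a + rho1 P -> 0 < (rho2 P - rho1 P) * b + rho1 P ->
  r P a b * (a - b) = rho P a - rho P b.
Proof.
case: hpos => _ _ [r1 r2 _ _] _ _ ha hb; rewrite /r /alpha /rho; field.
by rewrite !lt0r_neq0.
Qed.

Lemma g_secant (a b : R) : g a b * (a - b) = F a - F b.
Proof. by rewrite /g /F; field. Qed.

(** Each of the products rho F and rho |grad c|^2 is differenced by the rule for a
    product of means and increments; the secant properties of g and r recognize
    the increments of F and rho in [J7] times the increment of c. *)
Lemma free_energy_balance s0 s1 :
  admissible P (conc s0) -> admissible P (conc s1) ->
  neumann P (conc s0) -> neumann P (conc s1) -> J7 P s0 s1 ->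
  (M P)^-1 * inner P (mubar s1) (rhoL P s0 *^ (conc s1 -^ conc s0))
  = eta P / (eps P * We P)
      * (inner P (rhoL P s1 *^ FL s1) (fun _ _ => 1)
         - inner P (rhoL P s0 *^ FL s0) (fun _ _ => 1))
    + eps P * eta P / (2 * We P)
      * ((inner P (rhoL P s1) (ax (gsqr (Dx P (conc s1))))
          + inner P (rhoL P s1) (ay (gsqr (Dy P (conc s1)))))
         - (inner P (rhoL P s0) (ax (gsqr (Dx P (conc s0))))
            + inner P (rhoL P s0) (ay (gsqr (Dy P (conc s0)))))).
Proof.
case: (hpos) => [[M0 _ We0 _ _] [_ eps0 _ _] _ m1_gt0 m2_gt0] ad0 ad1 n0 n1 j7.
have M_neq0 := lt0r_neq0 M0; have We_neq0 := lt0r_neq0 We0.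
have eps_neq0 := lt0r_neq0 eps0.
set rhh := Defs.half (rhoL P s1) (rhoL P s0).
have gx := half_gradient_x m1_gt0 rhh n1 n0.
have gy := half_gradient_y m2_gt0 rhh n1 n0.
move: gx gy.
set Lx := inner P (_ -^ _) _; set Rx1 := inner P rhh _; set Rx0 := inner P rhh _.
move=> gx.
set Ly := inner P (_ -^ _) _; set Ry1 := inner P rhh _; set Ry0 := inner P rhh _.
move=> gy.
set W1 := inner P (_ *^ _) _; set W0 := inner P (_ *^ _) _.
set X1 := inner _ _ (ax _); set Y1 := inner _ _ (ay _).
set X0 := inner _ _ (ax _); set Y0 := inner _ _ (ay _).
(* The increment of rho |grad c|^2 is the mean of |grad c|^2 times the increment
   of rho, plus the mean of rho times the increment of |grad c|^2. *)
pose T := cell_sum P (Defs.half (sqgrad P (conc s1)) (sqgrad P (conc s0))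
                      *^ (rhoL P s1 -^ rhoL P s0)).
have split_grad : X1 + Y1 - (X0 + Y0) = T + (Rx1 + Ry1 - (Rx0 + Ry0)).
  suff : X1 + Y1 + -1 * (X0 + Y0) = T + (Rx1 + Ry1 + -1 * (Rx0 + Ry0)) by rewrite !mulN1r.
  rewrite /X1 /X0 /Y1 /Y0 /T /Rx1 /Rx0 /Ry1 /Ry0 /inner -!/(cell_sum P (_ *^ _)).
  rewrite -!cell_sumD -!cell_sumZ -!cell_sumD; apply: eq_cell_sum => i j _ _.
  by rewrite /gmul /gadd /gsub /gscale /rhh /Defs.half /sqgrad /gscale /gadd; field.
have -> : (M P)^-1 * inner P (mubar s1) (rhoL P s0 *^ (conc s1 -^ conc s0))
   = eta P / (eps P * We P) * (W1 + -1 * W0) + eps P * eta P / (2 * We P) * T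
     - eps P * eta P / We P * (Lx + Ly).
  rewrite -mulNr /W1 /W0 /T /Lx /Ly /inner -!/(cell_sum P (_ *^ _)).
  rewrite -!cell_sumD -!cell_sumZ -!cell_sumD -!cell_sumZ -!cell_sumD.
  apply: eq_cell_sum => i j /andP[i1 im] /andP[j1 jm].
  have [a0 _] := ad0 i j (leqW im) (leqW jm); have [a1 _] := ad1 i j (leqW im) (leqW jm).
  have er := r_secant a1 a0; have eg := g_secant (conc s1 i j) (conc s0 i j).
  rewrite /gmul /gadd /gscale.
  transitivity ((M P)^-1 * (rhoL P s0 i j * mubar s1 i j) * (conc s1 i j - conc s0 i j)).
    by rewrite /gsub; ring.
  rewrite j7 ?i1 ?j1 // -/rhh.
  set gg := g _ _ in eg *; set rr := r _ _ _ in er *.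
  transitivity (eta P / (eps P * We P)
      * (rhh i j * (gg * (conc s1 i j - conc s0 i j))
         + Defs.half (FL s1) (FL s0) i j * (rr * (conc s1 i j - conc s0 i j)))
    + eps P * eta P / (2 * We P)
      * (Defs.half (sqgrad P (conc s1)) (sqgrad P (conc s0)) i j
         * (rr * (conc s1 i j - conc s0 i j)))
    - eps P * eta P / We P * ((conc s1 -^ conc s0) i j
        * (dx P (Ax rhh *^ Dx P (Defs.half (conc s1) (conc s0))) i j
          + dy P (Ay rhh *^ Dy P (Defs.half (conc s1) (conc s0))) i j))).
    rewrite /gsub; field.
    by rewrite M_neq0 eps_neq0 We_neq0.
  rewrite eg er /rhh /rhoL /FL /on_grid /Defs.half /gsub /gscale /gadd; field.
  by rewrite eps_neq0 We_neq0.
rewrite split_grad gx gy; field.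
by rewrite eps_neq0 We_neq0.
Qed.

(** Multiplying the divergence constraint by rho^(n+1) and eliminating Q, every
    difference of c, in time or between neighbouring cells, comes with the product
    of the two densities at its ends, hence is a difference of rho. *)
Lemma density_balance s0 s1 i j :
  admissible P (conc s0) -> admissible P (conc s1) ->
  J5 P s0 s1 -> J6 P s0 s1 ->
  (1 <= i <= m1 P)%N -> (1 <= j <= m2 P)%N ->
  rhoL P s1 i j - rhoL P s0 i j
  = - dt P * (dx P (Ax (rhoL P s1) *^ uvel s1) i j
              + dy P (Ay (rhoL P s1) *^ vvel s1) i j).
Proof.
case: (hpos) => [_ [_ _ dt0 h0] _ _ _] ad0 ad1 j5 j6 hi hj.
have dt_neq0 := lt0r_neq0 dt0; have h_neq0 := lt0r_neq0 h0.
have e5 := j5 i j hi hj; have e6 := j6 i j hi hj; rewrite -{}e6 in e5.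
case/andP: hi hj => i1 im /andP[j1 jm].
have r_diff k l : (k <= (m1 P).+1)%N -> (l <= (m2 P).+1)%N ->
    alpha P * rhoL P s1 i j * (rhoL P s1 k l * (conc s1 k l - conc s1 i j))
    = rhoL P s1 i j - rhoL P s1 k l.
  move=> hk hl; have [a _] := ad1 _ _ hk hl; have [b _] := ad1 i j (leqW im) (leqW jm).
  rewrite /rhoL /on_grid -[RHS]opprB -(r_secant a b) /r; ring.
have r_time : alpha P * rhoL P s1 i j * (rhoL P s0 i j * (conc s1 i j - conc s0 i j))
    = rhoL P s0 i j - rhoL P s1 i j.
  have [a _] := ad0 i j (leqW im) (leqW jm); have [b _] := ad1 i j (leqW im) (leqW jm).
  rewrite /rhoL /on_grid -[RHS]opprB -(r_secant b a) /r; ring.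
have rE := r_diff i.+1 j im (leqW jm).
have rW := r_diff i.-1 j (leq_trans (leq_pred i) (leqW im)) (leqW jm).
have rN := r_diff i j.+1 (leqW im) jm.
have rS := r_diff i j.-1 (leqW im) (leq_trans (leq_pred j) (leqW jm)).
have key : dt P * rhoL P s1 i j * (dx P (uvel s1) i j + dy P (vvel s1) i j)
  = alpha P * rhoL P s1 i j * (rhoL P s0 i j * (conc s1 i j - conc s0 i j))
    + dt P / (2 * h P)
      * (alpha P * rhoL P s1 i j
         * (rhoL P s1 i.+1 j * (conc s1 i.+1 j - conc s1 i j)) * uvel s1 i j
         - alpha P * rhoL P s1 i j
         * (rhoL P s1 i.-1 j * (conc s1 i.-1 j - conc s1 i j)) * uvel s1 i.-1 j
         + alpha P * rhoL P s1 i j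
         * (rhoL P s1 i j.+1 * (conc s1 i j.+1 - conc s1 i j)) * vvel s1 i j
         - alpha P * rhoL P s1 i j
         * (rhoL P s1 i j.-1 * (conc s1 i j.-1 - conc s1 i j)) * vvel s1 i j.-1).
  rewrite e5 /adv_x /adv_y /Dx /Dy !prednK //; field.
  by rewrite dt_neq0 h_neq0.
rewrite {}r_time {}rE {}rW {}rN {}rS in key.
apply/eqP; rewrite -subr_eq0; move/eqP: key; rewrite -subr_eq0 => /eqP <-.
apply/eqP; rewrite /dx /dy /gmul /Ax /Ay !prednK //; field.
by rewrite h_neq0.
Qed.

(** The divergence constraint pairs the pressure with alpha Q and the equation of c
    pairs mubar with Q, which together form the chemical potential. *)
Lemma work_balance s0 s1 :
  J5 P s0 s1 -> J6 P s0 s1 ->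
  dt P / M P * (inner P (pres s1) (dx P (uvel s1))
      + inner P (mubar s1) (adv_x P (rhoL P s1) (conc s1) (uvel s1)))
    + dt P / M P * (inner P (pres s1) (dy P (vvel s1))
      + inner P (mubar s1) (adv_y P (rhoL P s1) (conc s1) (vvel s1)))
  = dt P / M P * inner P (chem P s1) (Q P s0 s1)
    - (M P)^-1 * inner P (mubar s1) (rhoL P s0 *^ (conc s1 -^ conc s0)).
Proof.
case: (hpos) => [[M0 _ _ _ _] [_ _ dt0 _] _ _ _] j5 j6.
rewrite -mulNr /inner -!/(cell_sum P (_ *^ _)).
rewrite -!cell_sumD -!cell_sumZ -!cell_sumD; apply: eq_cell_sum => i j hi hj.
have e5 := j5 i j hi hj; have e6 := j6 i j hi hj.
rewrite /gadd /gscale /gmul /chem /gadd /gscale /gsub.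
transitivity (dt P / M P * (pres s1 i j * (dx P (uvel s1) i j + dy P (vvel s1) i j)
  + mubar s1 i j * (adv_x P (rhoL P s1) (conc s1) (uvel s1) i j
      + adv_y P (rhoL P s1) (conc s1) (vvel s1) i j))); first by ring.
rewrite e5 -e6; field.
by rewrite !lt0r_neq0.
Qed.

(** Summation by parts against the height: D_y y = 1 and D_x y = 0. *)
Lemma mass_balance s0 s1 :
  admissible P (conc s0) -> admissible P (conc s1) ->
  no_penetration P (uvel s1) (vvel s1) ->
  J5 P s0 s1 -> J6 P s0 s1 ->
  inner P (rhoL P s1 *^ ycell P) (fun _ _ => 1)
  - inner P (rhoL P s0 *^ ycell P) (fun _ _ => 1)
  = dt P * ns_sum P (Ay (rhoL P s1) *^ vvel s1).
Proof.
case: (hpos) => [_ [_ _ dt0 h0] _ m1_gt0 m2_gt0] ad0 ad1 [uw vw] j5 j6.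
have h_neq0 := lt0r_neq0 h0.
transitivity (- dt P * (inner P (ycell P) (dx P (Ax (rhoL P s1) *^ uvel s1))
   + inner P (ycell P) (dy P (Ay (rhoL P s1) *^ vvel s1)))).
  apply/eqP; rewrite subr_eq; apply/eqP.
  rewrite /inner -!/(cell_sum P (_ *^ _)) -cell_sumD -cell_sumZ -cell_sumD.
  apply: eq_cell_sum => i j hi hj; have e := density_balance ad0 ad1 j5 j6 hi hj.
  move/eqP: e; rewrite subr_eq => /eqP e.
  by rewrite /gmul /gadd /gscale e /gmul; ring.
rewrite inner_dx ?inner_dy //; try by [exact: ew_wall0_mul | exact: ns_wall0_mul].
have -> : ew_sum P (Dx P (ycell P) *^ (Ax (rhoL P s1) *^ uvel s1)) = 0.
  apply: big1 => i _; apply: big1 => j _.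
  by rewrite /gmul /Dx /ycell subrr !mul0r.
rewrite oppr0 add0r mulrNN; congr (_ * _); apply: eq_ns_sum => i j _ _.
rewrite /gmul /Dy /ycell -natr1; field.
by rewrite h_neq0.
Qed.

End Balances.

(** * Nonnegativity of the norms *)

Section Positivity.
Variables (R : rcfType) (P : params R).
Hypothesis hpos : params_pos P.

Definition cell_ge0 (f : cell R) :=
  forall i j, (1 <= i <= m1 P)%N -> (1 <= j <= m2 P)%N -> 0 <= f i j.

Lemma inner_ge0 (f k : cell R) :
  cell_ge0 f -> (forall i j, 0 <= k i j) -> 0 <= inner P f k.
Proof.
move=> hf hk; rewrite /inner big_nat_cond; apply: sumr_ge0 => i /andP[hi _].
rewrite big_nat_cond; apply: sumr_ge0 => j /andP[hj _].
by rewrite mulr_ge0 // hf.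
Qed.

Lemma ax_sqr_ge0 (u : grid R) i j : 0 <= ax (gsqr u) i j.
Proof. by rewrite divr_ge0 ?addr_ge0 ?sqr_ge0 ?ler0n. Qed.

Lemma ay_sqr_ge0 (u : grid R) i j : 0 <= ay (gsqr u) i j.
Proof. by rewrite divr_ge0 ?addr_ge0 ?sqr_ge0 ?ler0n. Qed.

Lemma vbar_sqr_ge0 (w : grid R) i j : 0 <= vbar (gsqr w) i j.
Proof. by rewrite divr_ge0 ?addr_ge0 ?sqr_ge0 ?ler0n. Qed.

Lemma norm2_vel_ge0 f u v : cell_ge0 f -> 0 <= norm2_vel P f u v.
Proof.
move=> hf; apply: addr_ge0; apply: mulr_ge0; rewrite ?sqr_ge0 //;
  apply: inner_ge0 => // i j.
- exact: ax_sqr_ge0.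
- exact: ay_sqr_ge0.
Qed.

Lemma norm2_gradD_ge0 f c : cell_ge0 f -> 0 <= norm2_gradD P f c.
Proof. exact: norm2_vel_ge0. Qed.

Lemma norm2_gradd_ge0 f u v : cell_ge0 f -> 0 <= norm2_gradd P f u v.
Proof.
move=> hf; rewrite /norm2_gradd -!mulrDr; apply: mulr_ge0; rewrite ?sqr_ge0 //.
by do 3?[apply: addr_ge0]; apply: inner_ge0 => // i j; rewrite ?sqr_ge0 ?vbar_sqr_ge0.
Qed.

Lemma norm2_divd_ge0 f u v : cell_ge0 f -> 0 <= norm2_divd P f u v.
Proof.
move=> hf; apply: mulr_ge0; rewrite ?sqr_ge0 //.
by apply: inner_ge0 => // i j; rewrite sqr_ge0.
Qed.

Lemma rhoL_ge0 s : admissible P (conc s) -> cell_ge0 (rhoL P s).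
Proof.
case: hpos => _ _ [r1 r2 _ _] _ _ ad i j /andP[_ im] /andP[_ jm].
have [a _] := ad i j (leqW im) (leqW jm).
by rewrite /rhoL /on_grid /rho divr_ge0 ?mulr_ge0 ?ltW.
Qed.

Lemma muL_ge0 s : admissible P (conc s) -> cell_ge0 (muL P s).
Proof.
case: hpos => _ _ [_ _ r1 r2] _ _ ad i j /andP[_ im] /andP[_ jm].
have [_ a] := ad i j (leqW im) (leqW jm).
by rewrite /muL /on_grid /mu divr_ge0 ?mulr_ge0 ?ltW.
Qed.
End Positivity.

(** * The energy law *)

Theorem theorem6p4 (R : rcfType) (P : params R) (s : nat -> level R)
  (hpos : params_pos P) (hL : Lx P = Ly P)
  (hadm : forall n : nat, admissible P (conc (s n)))
  (hscheme : forall n : nat, scheme P (s n) (s n.+1))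
  (hbc : forall n : nat, boundary_conditions P (s n))
  (n : nat) :
  let dissipation : R :=
    - (dt P / Rey P
        * norm2_gradd P (muL P (s n)) (utilde (s n.+1)) (vtilde (s n.+1)))
    - dt P / (3 * Rey P)
        * norm2_divd P (muL P (s n)) (utilde (s n.+1)) (vtilde (s n.+1))
    - dt P / (M P * Pe P)
        * norm2_gradD P (mobL P (s n)) (chem P (s n.+1))
    - 2^-1 * norm2_vel P (rhoL P (s n))
        (utilde (s n.+1) -^ uvel (s n)) (vtilde (s n.+1) -^ vvel (s n))
    - 2^-1 * norm2_vel P (rhoL P (s n.+1))
        (uvel (s n.+1) -^ utilde (s n.+1)) (vvel (s n.+1) -^ vtilde (s n.+1)) in
  energy P (s n.+1) - energy P (s n) = dissipation /\ dissipation <= 0.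
Proof.
move=> dissipation; split; last first.
  case: (hpos) => [[M0 Re0 _ _ Pe0] [_ _ dt0 _] _ _ _].
  have r0 := rhoL_ge0 hpos (hadm n); have r1 := rhoL_ge0 hpos (hadm n.+1).
  have v0 := muL_ge0 hpos (hadm n).
  have mob0 : cell_ge0 P (mobL P (s n)) by move=> i j _ _; apply: sqrtr_ge0.
  rewrite /dissipation -!opprD oppr_le0.
  do 4?[apply: addr_ge0]; apply: mulr_ge0;
    rewrite ?(norm2_gradd_ge0, norm2_divd_ge0, norm2_gradD_ge0, norm2_vel_ge0) //.
  - by rewrite divr_ge0 ?ltW.
  - by rewrite divr_ge0 ?mulr_ge0 ?ltW.
  - by rewrite divr_ge0 ?mulr_ge0 ?ltW.
  - by rewrite invr_ge0.
  - by rewrite invr_ge0.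
have [[M0 Re0 We0 Fr0 Pe0] [eta0 eps0 dt0 h0] _ m1_gt0 m2_gt0] := hpos.
have [[j1 j2 j3 j4] j5 j6 j7] := hscheme n.
have [nc0 _ _ pen0] := hbc n; have [nc1 nchem slip1 pen1] := hbc n.+1.
have ad0 := hadm n; have ad1 := hadm n.+1.
have mx := momentum_x hpos (hbc n) (hbc n.+1) j1.
have my := momentum_y hpos (hbc n) (hbc n.+1) j2.
have px := projection_x hpos pen1 j3.
have py := projection_y hpos pen1 j4.
have ch := chem_dissipation m1_gt0 m2_gt0 (s n) nchem.
have fe := free_energy_balance hpos ad0 ad1 nc0 nc1 j7.
have mb := mass_balance hpos ad0 ad1 pen1 j5 j6.
have work := work_balance hpos j5 j6.
set s0 := s n in dissipation *; set s1 := s n.+1 in dissipation *.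
have utw : ew_wall0 P (utilde s1) by case: slip1.
have vtw : ns_wall0 P (vtilde s1) by case: slip1.
have divergence := viscous_divergence m1_gt0 m2_gt0 (muL P s0) utw vtw.
have [u0w v0w] := pen0; have [u1w v1w] := pen1.
rewrite /dissipation /energy /norm2_vel /norm2_gradD /norm2_gradd /norm2_divd.
have kx f u : ew_wall0 P u -> ew_sum P (Ax f *^ gsqr u) = inner P f (ax (gsqr u)).
  by move=> /ew_wall0_sqr w; rewrite inner_ax.
have ky f v : ns_wall0 P v -> ns_sum P (Ay f *^ gsqr v) = inner P f (ay (gsqr v)).
  by move=> /ns_wall0_sqr w; rewrite inner_ay.
rewrite !kx // in mx px; try exact: ew_wall0_sub.
rewrite !ky // in my py; try exact: ns_wall0_sub.
(* The coefficients are those for which the exchanged quantities cancel: the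
   kinetic energy of the intermediate velocity, the grad-div work, the work of
   pressure and surface tension, and the work of gravity. *)
have add_eqs (a b c d : R) : a = b -> c = d -> a + c = b + d by move=> -> ->.
have scale k (a b : R) : a = b -> k * a = k * b by move=> ->.
have momentum := add_eqs _ _ _ _ (add_eqs _ _ _ _ mx my)
  (scale (dt P / (3 * Rey P)) _ _ divergence).
have projection := add_eqs _ _ _ _ (add_eqs _ _ _ _ px py)
  (add_eqs _ _ _ _ work (scale (dt P / M P) _ _ ch)).
have potential := add_eqs _ _ _ _ (scale (-1) _ _ fe) (scale (Fr P)^-1 _ _ mb).
have := scale (h P ^+ 2) _ _
  (add_eqs _ _ _ _ (add_eqs _ _ _ _ momentum projection) potential).
move/eqP; rewrite -subr_eq0 => /eqP tot; apply/eqP; rewrite -subr_eq0 -tot; apply/eqP.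
field.
by rewrite !lt0r_neq0.
Qed.
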